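(* Semisimple symplectic matrices with distinct eigenvalues are dense in the group of all symplectic matrices: for every $n\ge1$, the set of matrices in $\mathrm{Sp}(\mathbb{R}^{2n},\Omega_0)$ that are diagonalizable over $\mathbb{C}$ with $2n$ pairwise distinct eigenvalues is dense in $\mathrm{Sp}(\mathbb{R}^{2n},\Omega_0)$.
   Context: $\mathrm{Sp}(\mathbb{R}^{2n},\Omega_0)=\{A\in\mathrm{Mat}(2n\times2n,\mathbb{R}): A^\tau\Omega_0A=\Omega_0\}$ with $\Omega_0=\begin{pmatrix}0&\mathrm{Id}\\-\mathrm{Id}&0\end{pmatrix}$. A matrix $A$ is semisimple if $\mathbb{C}^{2n}$ is the direct sum of its eigenspaces. The topology is the usual one on matrices. *)

(* Defs.v *)
From HB Require Import structures.
From mathcomp Require Import all_boot all_order all_algebra.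
From mathcomp Require Import classical_sets functions reals topology normedtype.
From mathcomp Require Import complex.

Set Implicit Arguments.
Unset Strict Implicit.
Unset Printing Implicit Defensive.

Import GRing.Theory numFieldNormedType.Exports.

Local Open Scope classical_set_scope.
Local Open Scope ring_scope.

Definition Omega0 (R : realType) (n : nat) : 'M[R]_(n + n) :=
  block_mx 0 1%:M (- 1%:M) 0.

(* Used as a type, this set carries the topology induced by the usual topology
   of the space of matrices (see subtype_topology.v). *)
Definition Sp (R : realType) (n : nat) : set 'M[R]_(n + n) :=
  [set A | A^T *m Omega0 R n *m A = Omega0 R n].
Arguments Sp : clear implicits.

Definition complexify (R : realType) (m : nat) (A : 'M[R]_m) : 'M[R[i]]_m :=
  map_mx (real_complex R) A.

(* MathComp matrices act on row vectors, v |-> v *m A.  With A^T in place of A,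
   a row vector v lies in the eigenspace of c iff A *m v^T = c *: v^T, so these
   are the eigenspaces for the action of A on column vectors. *)
Definition col_eigenspace (F : fieldType) (m : nat) (A : 'M[F]_m) (c : F) :
  'M[F]_m := eigenspace A^T c.

Definition col_eigenvalue (F : fieldType) (m : nat) (A : 'M[F]_m) : pred F :=
  eigenvalue A^T.

(* F^m is the direct sum of the eigenspaces of A; the duplicate-free sequence s
   lists all the eigenvalues of A. *)
Definition semisimple (F : fieldType) (m : nat) (A : 'M[F]_m) : Prop :=
  exists s : seq F,
    [/\ uniq s,
        s =i col_eigenvalue A,
        mxdirect (\sum_(i < size s) col_eigenspace A s`_i)
      & (\sum_(i < size s) col_eigenspace A s`_i :=: 1%:M)%MS].

Definition distinct_eigenvalues (F : fieldType) (m : nat) (A : 'M[F]_m) :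
  Prop :=
  exists s : seq F, [/\ uniq s, size s = m & all (col_eigenvalue A) s].

(* Main.v *)
Require Import Defs.
From HB Require Import structures.
From mathcomp Require Import all_boot all_order all_algebra.
From mathcomp Require Import boolp classical_sets functions.
From mathcomp Require Import reals topology normedtype.
From mathcomp Require Import derive separable complex.

Set Implicit Arguments.
Unset Strict Implicit.
Unset Printing Implicit Defensive.

Import Order.TTheory GRing.Theory Num.Theory numFieldNormedType.Exports.

Local Open Scope classical_set_scope.
Local Open Scope ring_scope.

(** Having 2n distinct eigenvalues is an open condition given by one polynomial,
    the discriminant of the characteristic polynomial.  So it suffices to join
    an arbitrary symplectic A to one symplectic matrix with distinct eigenvalues
    by a path inside the symplectic group whose entries are rational functions
    of a parameter t: along such a path the discriminant is a nonzero rational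
    function, it has finitely many zeros, and there are points of the path
    arbitrarily close to A where it does not vanish.

    The path comes from a factorization of A into unipotent shears and a
    block-diagonal matrix.  Let b and d be the upper and lower right blocks of
    A.  If d is invertible, block Gaussian elimination writes A as an upper
    shear by a symmetric matrix, times diag (P, P^-T) with P = d^-T, times a
    lower shear by a symmetric matrix ([Sp_factor]).  In general, multiplying A
    on the left by a lower shear by the scalar matrix s replaces d by s b + d,
    and this is invertible for some real s, because det (X b + d) does not
    vanish at X = i ([Sp_generic_drblock]).

    Each of the four parameters of such a product moves in a linear space, so
    the shears can be contracted linearly to the identity while P moves linearly
    to diag (2, ..., n + 1).  The path ends at the diagonal matrix with entries
    2, ..., n + 1, 1/2, ..., 1/(n + 1), which are distinct.  The path is
    symplectic wherever P stays invertible, which excludes only finitely many t.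
    To stay within polynomial matrices, the path is multiplied by det P; this
    scales the eigenvalues and does not affect whether they are distinct. *)

(** * Distinct eigenvalues and the discriminant *)

Lemma char_poly_tr (K : comNzRingType) (m : nat) (A : 'M[K]_m) :
  char_poly A^T = char_poly A.
Proof.
rewrite /char_poly -[RHS]det_tr; congr (\det _).
by rewrite /char_poly_mx linearB /= tr_scalar_mx map_trmx.
Qed.

(** Eigenspaces of distinct eigenvalues are independent, and m nonzero
    independent subspaces fill a space of dimension m.  There is no further
    eigenvalue, since the m given ones already exhaust the characteristic
    polynomial. *)
Lemma distinct_eigenvalues_semisimple (F : fieldType) (m : nat) (A : 'M[F]_m) :
  distinct_eigenvalues A -> semisimple A.
Proof.
case=> s [us szs /allP evs]; exists s.
have direct : mxdirect (\sum_(i < size s) col_eigenspace A s`_i).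
  apply: mxdirect_sum_eigenspace => i j _ _ /eqP.
  by rewrite nth_uniq // => /eqP/val_inj.
have full : row_full (\sum_(i < size s) col_eigenspace A s`_i)%MS.
  rewrite -col_leq_rank (mxdirectP direct) /=.
  rewrite -[X in (X <= _)%N]szs -[X in (X <= _)%N]card_ord -sum1_card.
  apply: leq_sum => i _; rewrite lt0n mxrank_eq0.
  by apply: evs; rewrite mem_nth.
split=> //; last by apply/eqmxP; rewrite submx1 sub1mx full.
move=> a; apply/idP/idP => [/evs //|a_ev].
have {}a_ev : root (char_poly A^T) a by rewrite -eigenvalue_root_char.
have dvd_p : \prod_(z <- s) ('X - z%:P) %| char_poly A^T.
  apply: uniq_roots_dvdp; last by rewrite uniq_rootsE.
  by apply/allP => z /evs; rewrite /col_eigenvalue eigenvalue_root_char.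
have : \prod_(z <- s) ('X - z%:P) %= char_poly A^T.
  by rewrite -(dvdp_size_eqp dvd_p) size_prod_XsubC size_char_poly szs.
by move/eqp_root => /(_ a); rewrite a_ev root_prod_XsubC.
Qed.

Lemma distinct_eigenvaluesZ (F : fieldType) (m : nat) (c : F) (A : 'M[F]_m) :
  c != 0 -> distinct_eigenvalues A -> distinct_eigenvalues (c *: A).
Proof.
move=> c0 [s [us szs /allP evs]]; exists [seq c * z | z <- s].
split; [by rewrite map_inj_uniq //; exact: mulfI | by rewrite size_map |].
apply/allP => _ /mapP[z /evs/eigenvalueP[v vA v0] ->].
apply/eigenvalueP; exists v => //.
by rewrite linearZ /= -scalemxAr vA scalerA.
Qed.

Lemma separable_distinct_eigenvalues (F : closedFieldType) (m : nat)
    (A : 'M[F]_m) :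
  separable_poly (char_poly A) -> distinct_eigenvalues A.
Proof.
have [s] := closed_field_poly_normal (char_poly A).
rewrite (monicP (char_poly_monic A)) scale1r => pE sepA; exists s; split.
- by rewrite -separable_prod_XsubC -pE.
- by apply/eqP; rewrite -eqSS -(size_prod_XsubC s id) -pE size_char_poly.
apply/allP => z zs; rewrite /col_eigenvalue eigenvalue_root_char char_poly_tr.
by rewrite pE root_prod_XsubC.
Qed.

(** The hypothesis keeps the characteristic from dividing the degree, so that
    the derivative has the expected degree. *)
Lemma lead_coef_deriv_monic (K : nzRingType) (p : {poly K}) :
  p \is monic -> (size p).-1%:R != 0 :> K ->
  lead_coef p^`() = (size p).-1%:R.
Proof.
move=> p1 np; have pn0 : p != 0 by rewrite monic_neq0.
have szp : (0 < (size p).-1)%N by case: (size p).-1 np => //; rewrite eqxx.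
have cE : p^`()`_(size p).-2 = (size p).-1%:R.
  by rewrite coef_deriv prednK // -lead_coefE (monicP p1).
rewrite lead_coefE -cE; congr (_ `_ _); congr (_.-1).
apply/eqP; rewrite eqn_leq; apply/andP; split.
  by rewrite -ltnS prednK ?lt_size_deriv // size_poly_gt0.
rewrite -[X in (X <= _)%N](prednK szp) ltnNge; apply/negP => le_sz.
by move/eqP: np; apply; rewrite -cE nth_default.
Qed.

(** Up to sign, the resultant of a monic polynomial and its derivative is its
    discriminant.  It commutes with specialization at t because the leading
    coefficients, 1 and m, survive it.  This exhibits the parameters t for which
    the specialized matrix has a repeated eigenvalue in an algebraic closure as
    the roots of a single polynomial. *)
Lemma horner_resultant_char_poly (R : numFieldType) (m : nat)
    (M : 'M[{poly R}]_m) (t : R) : (0 < m)%N ->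
  ((resultant (char_poly M) (char_poly M)^`()).[t] != 0) =
  separable_poly (char_poly (map_mx (horner_eval t) M)).
Proof.
move=> m0; rewrite -[_.[t]]/(horner_eval t _).
have mR0 (K : numDomainType) : m%:R != 0 :> K by rewrite pnatr_eq0 -lt0n.
have lcp := monicP (char_poly_monic M).
have lcp' : lead_coef (char_poly M)^`() = m%:R.
  rewrite lead_coef_deriv_monic ?char_poly_monic ?size_char_poly //=.
  by rewrite -(rmorph_nat (@polyC R)) polyC_eq0 mR0.
rewrite map_resultant /= ?lcp ?lcp' ?rmorph1 ?oner_eq0 ?rmorph_nat ?mR0 //.
rewrite -deriv_map map_char_poly resultant_eq0 -leqNgt separable_poly.unlock.
rewrite /coprimep eqn_leq size_poly_gt0 gcdp_eq0.
by rewrite (negPf (monic_neq0 (char_poly_monic _))) andbT.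
Qed.

(** * Rational paths of matrices *)

(** The topology of matrices is the product topology over their entries. *)
Lemma cvg_coord_mx (T : Type) (V : topologicalType) (m n : nat)
    (F : set_system T) (f : T -> 'M[V]_(m, n)) (A : 'M[V]_(m, n)) :
  Filter F -> (forall i j, f x i j @[x --> F] --> A i j) -> f @ F --> A.
Proof.
move=> FF cvg_f U [P nP PU].
suff near_P : \forall x \near F, forall i j, P i j (f x i j).
  by apply: filterS near_P => x Px; exact: PU.
apply: filter_forall => i; apply: filter_forall => j.
exact: cvg_f (nP i j).
Qed.

Lemma cvg_rational_mx (R : realType) (m : nat) (M : 'M[{poly R}]_m)
    (d : {poly R}) (t : R) : d.[t] != 0 ->
  d.[u]^-1 *: map_mx (horner_eval u) M @[u --> t] -->
  d.[t]^-1 *: map_mx (horner_eval t) M.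
Proof.
move=> dt; apply: cvg_coord_mx => i j; rewrite !mxE.
under eq_fun do rewrite !mxE.
apply: cvgM; last exact: continuous_horner.
by apply: cvgV => //; exact: continuous_horner.
Qed.

(** Factoring out the largest power of X leaves a polynomial that does not
    vanish at 0, hence does not vanish near 0. *)
Lemma near0_horner_neq0 (R : realType) (q : {poly R}) : q != 0 ->
  \forall t \near (0 : R)^', q.[t] != 0.
Proof.
move=> q0; have [k [p]] := multiplicity_XsubC q 0.
rewrite q0 subr0 /= => p0 ->.
have pn : \forall t \near (0 : R)^', p.[t] != 0.
  apply: nbhs_dnbhs.
  have cp : p.[t] @[t --> (0 : R)] --> p.[0] by exact: continuous_horner.
  exact: (cvgr_neq0 _ cp p0).
near=> t; rewrite hornerM hornerXn mulf_neq0 ?expf_neq0 //.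
  by near: t.
near: t; exact: nbhs_dnbhs_neq.
Unshelve. all: by end_near. Qed.

(** * The symplectic group *)

(** The fourth block of the symplectic condition is minus the transpose of the
    second, which leaves three equations. *)
Lemma Sp_blockP (R : realType) (n : nat) (a b c d : 'M[R]_n) :
  Sp R n (block_mx a b c d) <->
  [/\ a^T *m c = c^T *m a, a^T *m d - c^T *m b = 1%:M
    & b^T *m d = d^T *m b].
Proof.
have tr_subr (x y z : 'M[R]_n) : y - x = z -> x^T - y^T = - z^T.
  by move=> <-; rewrite linearB opprB.
rewrite /Sp /= /Omega0 tr_block_mx !mulmx_block.
rewrite !(mulmx0, mulmx1, mulmxN, mulNmx, add0r, addr0).
split=> [/eq_block_mx[aa ab ba bb] | [ac ad bd]].
  split; apply/eqP; rewrite -subr_eq0 ?opprK.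
  - by rewrite addrC aa.
  - by rewrite [X in X - _]addrC ab subrr.
  - by rewrite addrC bb.
have da : - (d^T *m a) + b^T *m c = - 1%:M.
  by rewrite addrC -[1%:M]trmx1 -(tr_subr _ _ _ ad) !trmx_mul !trmxK.
by rewrite ac bd da !addNr addrC ad.
Qed.

Lemma Sp_mul (R : realType) (n : nat) (A B : 'M[R]_(n + n)) :
  Sp R n A -> Sp R n B -> Sp R n (A *m B).
Proof.
rewrite /Sp /= => spA spB.
by rewrite trmx_mul -!mulmxA [A^T *m _]mulmxA (mulmxA (A^T *m _)) spA mulmxA.
Qed.

Lemma Omega0_sqr (R : realType) (n : nat) :
  Omega0 R n *m Omega0 R n = - 1%:M.
Proof.
rewrite /Omega0 mulmx_block !(mulmx0, mul0mx, mulmx1, mul1mx, addr0, add0r).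
by rewrite scalar_mx_block opp_block_mx !oppr0.
Qed.

(** As Omega0 squares to -1, the equation A^T Omega0 A = Omega0 displays an
    explicit inverse of A. *)
Lemma Sp_mulmxV (R : realType) (n : nat) (A : 'M[R]_(n + n)) :
  Sp R n A -> A *m - (Omega0 R n *m A^T *m Omega0 R n) = 1%:M.
Proof.
rewrite /Sp /= => spA; apply: mulmx1C.
by rewrite mulNmx -!mulmxA (mulmxA A^T) spA Omega0_sqr opprK.
Qed.

Lemma Sp_tr (R : realType) (n : nat) (A : 'M[R]_(n + n)) :
  Sp R n A -> Sp R n A^T.
Proof.
move=> /Sp_mulmxV; rewrite mulmxN !mulmxA => /(congr1 (mulmxr (Omega0 R n))).
rewrite /= mulNmx -mulmxA Omega0_sqr mulmxN mulmx1 opprK mul1mx => AOA.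
by rewrite /Sp /= trmxK.
Qed.

(** * Factorization into shears *)

Definition shear_lo (K : comNzRingType) (n : nat) (T : 'M[K]_n) :
  'M[K]_(n + n) := block_mx 1%:M 0 T 1%:M.

Definition shear_up (K : comNzRingType) (n : nat) (S : 'M[K]_n) :
  'M[K]_(n + n) := block_mx 1%:M S 0 1%:M.

Lemma Sp_shear_lo (R : realType) (n : nat) (T : 'M[R]_n) :
  T^T = T -> Sp R n (shear_lo T).
Proof.
move=> symT; apply/Sp_blockP.
by rewrite !(trmx1, trmx0, mul1mx, mulmx1, mulmx0, mul0mx, subr0) symT.
Qed.

Lemma Sp_shear_up (R : realType) (n : nat) (S : 'M[R]_n) :
  S^T = S -> Sp R n (shear_up S).
Proof.
move=> symS; apply/Sp_blockP.
by rewrite !(trmx1, trmx0, mul1mx, mulmx1, mulmx0, mul0mx, subr0) symS.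
Qed.

Lemma Sp_levi (R : realType) (n : nat) (P : 'M[R]_n) :
  P \in unitmx -> Sp R n (block_mx P 0 0 (invmx P)^T).
Proof.
move=> uP; apply/Sp_blockP; split.
- by rewrite !(trmx0, mulmx0, mul0mx).
- by rewrite !(trmx0, mulmx0, subr0) -trmx_mul mulVmx // trmx1.
- by rewrite !(trmx0, mulmx0, mul0mx).
Qed.

(** Block Gaussian elimination with pivot d.  The shear parameters b d^-1 and
    d^-1 c are symmetric because b^T d and c d^T are; the symmetry of the second
    product is the symplectic condition of the transpose. *)
Lemma Sp_factor (R : realType) (n : nat) (a b c d : 'M[R]_n) :
  Sp R n (block_mx a b c d) -> d \in unitmx ->
  let S := b *m invmx d in let T := invmx d *m c in
  [/\ S^T = S, T^T = T & block_mx a b c d =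
    shear_up S *m block_mx (invmx d)^T 0 0 d *m shear_lo T].
Proof.
move=> spA ud S T; have [_ ad bd] := (Sp_blockP _ _ _ _).1 spA.
have := Sp_tr spA; rewrite tr_block_mx => /Sp_blockP[_ _].
rewrite !trmxK => cd.
have udT : d^T \in unitmx by rewrite unitmx_tr.
have symS : S^T = S.
  apply: (can_inj (mulKmx udT)); apply: (can_inj (mulmxK ud)).
  by rewrite /S trmx_mul trmx_inv mulKVmx // mulmxA mulmxKV.
have symT : T^T = T.
  apply: (can_inj (mulKmx ud)); apply: (can_inj (mulmxK udT)).
  by rewrite /T trmx_mul trmx_inv mulKVmx // mulmxA mulmxKV.
split=> //; rewrite !mulmx_block.
rewrite !(mulmx0, mul0mx, mulmx1, mul1mx, addr0, add0r) /S /T.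
rewrite mulmxKV // mulKVmx //; congr block_mx.
apply: (can_inj (mulKmx udT)); rewrite mulmxDr trmx_inv mulmxV //.
rewrite !mulmxA -bd mulmxK //.
have /(congr1 trmx) := ad; rewrite linearB /= !trmx_mul !trmxK trmx1 => <-.
by rewrite subrK.
Qed.

Lemma row_gram_ge0 (R : realDomainType) (m : nat) (u : 'rV[R]_m) :
  0 <= (u *m u^T) 0 0.
Proof. by rewrite mxE sumr_ge0 // => i _; rewrite mxE -expr2 sqr_ge0. Qed.

Lemma row_gram_eq0 (R : realDomainType) (m : nat) (u : 'rV[R]_m) :
  (u *m u^T) 0 0 = 0 -> u = 0.
Proof.
rewrite mxE; under eq_bigr do rewrite mxE -expr2; move=> sum0.
apply/rowP => i; rewrite mxE; apply/eqP; rewrite -sqrf_eq0.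
by apply/eqP; apply: (psumr_eq0P _ sum0) => // j _; exact: sqr_ge0.
Qed.

(** If v is killed by d^T d + b^T b, then |d v|^2 + |b v|^2 = 0, so the last
    block column of A kills v; but A is invertible. *)
Lemma Sp_rblock_gram_unit (R : realType) (n : nat) (a b c d : 'M[R]_n) :
  Sp R n (block_mx a b c d) -> d^T *m d + b^T *m b \in unitmx.
Proof.
move=> /Sp_mulmxV/mulmx1_unit[uA _].
rewrite -row_free_unit -kermx_eq0; apply/rowV0P => v /sub_kermxP.
have vv (x : 'M[R]_n) : v *m (x^T *m x) *m v^T = (v *m x^T) *m (v *m x^T)^T.
  by rewrite trmx_mul trmxK !mulmxA.
move=> /(congr1 (fun w : 'rV_n => (w *m v^T) 0 0)).
rewrite mulmxDr mulmxDl !vv mul0mx mxE [RHS]mxE => /eqP.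
rewrite paddr_eq0 ?row_gram_ge0 // => /andP[/eqP/row_gram_eq0 vd].
move=> /eqP/row_gram_eq0 vb.
have : row_mx 0 v *m (block_mx a b c d)^T = 0.
  by rewrite tr_block_mx mul_row_block vd vb !mul0mx !addr0 row_mx0.
rewrite -[RHS](mul0mx _ (block_mx a b c d)^T).
move/(can_inj (mulmxK _)); rewrite unitmx_tr => /(_ uA)/eqP.
by rewrite row_mx_eq0 => /andP[_ /eqP].
Qed.

(** The morphism f allows the determinant of a pencil over K to be evaluated at
    a point of an extension of K. *)
Lemma horner_map_det_pencil (K L : comNzRingType) (f : {rmorphism K -> L})
    (m : nat) (b d : 'M[K]_m) (z : L) :
  (map_poly f (\det ('X *: map_mx polyC b + map_mx polyC d))).[z] =
  \det (z *: map_mx f b + map_mx f d).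
Proof.
rewrite -[LHS]/(horner_eval z _) -!det_map_mx; congr (\det _).
apply/matrixP => i j; rewrite !mxE.
by rewrite /= /horner_eval rmorphD rmorphM /= map_polyX !map_polyC !hornerE.
Qed.

(** The polynomial det (X b + d) is nonzero because its value at the imaginary
    unit i is: the symmetry of b^T d makes the cross terms of
    (d^T - i b^T) (i b + d) cancel, and d^T d + b^T b remains, which is
    invertible. *)
Lemma Sp_generic_drblock (R : realType) (n : nat) (a b c d : 'M[R]_n) :
  Sp R n (block_mx a b c d) -> exists s : R, s *: b + d \in unitmx.
Proof.
move=> spA; have [_ _ bd] := (Sp_blockP _ _ _ _).1 spA.
pose q : {poly R} := \det ('X *: map_mx polyC b + map_mx polyC d).
suff /near0_horner_neq0/filter_ex[s qs] : q != 0.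
  exists s; rewrite unitmxE unitfE; move: qs.
  by rewrite -[q](@map_poly_id _ idfun) // horner_map_det_pencil !map_mx_id.
pose rc := real_complex R.
have qi := horner_map_det_pencil rc b d 'i.
apply/eqP => q0; move: qi; rewrite -/q q0 rmorph0 horner0 => /esym detW.
have : map_mx rc (d^T *m d + b^T *m b) =
    (map_mx rc d^T - 'i *: map_mx rc b^T) *m ('i *: map_mx rc b + map_mx rc d).
  rewrite mulmxDr !mulmxDl !mulNmx -!scalemxAr -!scalemxAl scalerA.
  rewrite -expr2 sqrCi scaleN1r opprK -!map_mxM bd map_mxD.
  by rewrite [RHS]addrC addrA subrK.
move=> /(congr1 determinant); rewrite det_mulmx detW mulr0 det_map_mx.
move/eqP; rewrite fmorph_eq0 => /eqP detG; have := Sp_rblock_gram_unit spA.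
by rewrite unitmxE detG unitr0.
Qed.

(** * The path to a diagonal matrix *)

(** This is det P times diag (P, P^-T), written without division so that it
    makes sense over a ring of polynomials. *)
Definition scaled_levi (K : comNzRingType) (n : nat) (P : 'M[K]_n) :
  'M[K]_(n + n) := block_mx (\det P *: P) 0 0 (\adj P)^T.

(** For symmetric N, S, T and invertible P, this is det P times a product of
    symplectic matrices.  It is a polynomial expression in its four parameters,
    hence commutes with specialization. *)
Definition scaled_gauss (K : comNzRingType) (n : nat) (N S P T : 'M[K]_n) :
  'M[K]_(n + n) :=
  shear_lo N *m shear_up S *m scaled_levi P *m shear_lo T.

Lemma map_scaled_gauss (K L : comNzRingType) (f : {rmorphism K -> L}) (n : nat)
    (N S P T : 'M[K]_n) :
  map_mx f (scaled_gauss N S P T) =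
  scaled_gauss (map_mx f N) (map_mx f S) (map_mx f P) (map_mx f T).
Proof.
rewrite /scaled_gauss /shear_lo /shear_up /scaled_levi !map_mxM !map_block_mx.
by rewrite !map_mx1 !map_mx0 map_mxZ -map_trmx map_mx_adj det_map_mx.
Qed.

Lemma scaled_leviE (R : realType) (n : nat) (P : 'M[R]_n) :
  P \in unitmx ->
  (\det P)^-1 *: scaled_levi P = block_mx P 0 0 (invmx P)^T.
Proof.
move=> uP; rewrite /scaled_levi scale_block_mx !scaler0 scalerA mulVf.
  by rewrite scale1r /invmx uP linearZ.
by rewrite -unitfE -unitmxE.
Qed.

Lemma Sp_scaled_gauss (R : realType) (n : nat) (N S P T : 'M[R]_n) :
  N^T = N -> S^T = S -> T^T = T -> P \in unitmx ->
  Sp R n ((\det P)^-1 *: scaled_gauss N S P T).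
Proof.
move=> symN symS symT uP; rewrite /scaled_gauss scalemxAl scalemxAr.
rewrite scaled_leviE //; apply: Sp_mul; last exact: Sp_shear_lo.
apply: Sp_mul; last exact: Sp_levi.
by apply: Sp_mul; [exact: Sp_shear_lo | exact: Sp_shear_up].
Qed.

(** A first lower shear makes the lower right block invertible; it is moved to
    the other side after the elimination. *)
Lemma Sp_scaled_gauss_factor (R : realType) (n : nat) (A : 'M[R]_(n + n)) :
  Sp R n A -> exists N S P T : 'M[R]_n,
    [/\ N^T = N, S^T = S, T^T = T & P \in unitmx] /\
    A = (\det P)^-1 *: scaled_gauss N S P T.
Proof.
move=> spA; have := spA; rewrite -{1}(submxK A) => /Sp_generic_drblock[s ud].
pose N : 'M[R]_n := s%:M.
have symN : N^T = N by exact: tr_scalar_mx.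
have : Sp R n (shear_lo N *m A) by apply: Sp_mul => //; exact: Sp_shear_lo.
rewrite -{1}(submxK A) mulmx_block !(mul1mx, mul0mx, addr0) !mul_scalar_mx.
set d := s *: _ + _ in ud *; set c := s *: _ + _.
move=> /Sp_factor/(_ ud)[].
set S := _ *m invmx d; set T := invmx d *m c => symS symT NA.
exists (- N), S, (invmx d)^T, T; split.
  by rewrite linearN /= symN unitmx_tr unitmx_inv.
rewrite scalemxAl scalemxAr scaled_leviE ?unitmx_tr ?unitmx_inv //.
have -> : (invmx (invmx d)^T)^T = d by rewrite -trmx_inv trmxK invmxK.
rewrite -!mulmxA [shear_up _ *m _]mulmxA -NA.
rewrite mulmx_block !(mul1mx, mul0mx, mulmx1, mulmx0, addr0, add0r).
by rewrite !mulNmx !mul_scalar_mx /c /d !addKr submxK.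
Qed.

(** Up to a scalar factor, the matrix is diagonal with entries 2, ..., n + 1
    and their inverses; the former exceed 1 and the latter are below 1. *)
Lemma separable_scaled_levi (R : realType) (n : nat) :
  separable_poly
    (char_poly (scaled_levi (diag_mx (\row_(i < n) (i.+2%:R : R))))).
Proof.
set D := diag_mx _.
have uD : D \in unitmx.
  rewrite unitmxE det_diag unitfE; apply/prodf_neq0 => i _.
  by rewrite mxE pnatr_eq0.
have detD0 : \det D != 0 by rewrite -unitfE -unitmxE.
have invD : invmx D = diag_mx (\row_(i < n) (i.+2%:R : R)^-1).
  apply: (can_inj (mulKmx uD)); rewrite mulmxV // mulmx_diag -diag_const_mx.
  by congr diag_mx; apply/rowP => i; rewrite !mxE mulfV // pnatr_eq0.
pose e := row_mx (\row_(i < n) (i.+2%:R : R)) (\row_(i < n) (i.+2%:R : R)^-1).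
have -> : scaled_levi D = diag_mx (\det D *: e).
  rewrite linearZ /= diag_mx_row -/D -invD -[RHS]/(\det D *: block_mx _ _ _ _).
  by rewrite -[scaled_levi D]scale1r -(mulfV detD0) -scalerA scaled_leviE //
    invD tr_diag_mx.
rewrite char_poly_trig ?diag_mx_is_trig //.
rewrite -(big_map (fun i => diag_mx (\det D *: e) i i) xpredT
  (fun z => 'X - z%:P)) separable_prod_XsubC map_inj_uniq ?index_enum_uniq //.
have e_small (i : 'I_n) : (i.+2%:R : R)^-1 < 1.
  by rewrite invf_lt1 ?ltr0n // ltr1n.
have e_large (i : 'I_n) : 1 < i.+2%:R :> R by rewrite ltr1n.
move=> i j; rewrite ![diag_mx _ _ _]mxE !eqxx !mulr1n ![(_ *: e) _ _]mxE.
move/(mulfI detD0); rewrite /e.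
case: (split_ordP i) => i' ->; case: (split_ordP j) => j' ->;
  rewrite ?(row_mxEl, row_mxEr) !mxE.
- by move/eqP; rewrite eqr_nat => /eqP[/val_inj ->].
- by move=> ij; have := e_large i'; rewrite ij ltNge ltW.
- by move=> ij; have := e_large j'; rewrite -ij ltNge ltW.
- by move/invr_inj/eqP; rewrite eqr_nat => /eqP[/val_inj ->].
Qed.

Definition segment_mx (K : comNzRingType) (m : nat) (B C : 'M[K]_m) :
  'M[{poly K}]_m := (1 - 'X) *: map_mx polyC B + 'X *: map_mx polyC C.

Lemma horner_segment_mx (K : comNzRingType) (m : nat) (B C : 'M[K]_m) (t : K) :
  map_mx (horner_eval t) (segment_mx B C) = (1 - t) *: B + t *: C.
Proof. by apply/matrixP => i j; rewrite !mxE /horner_eval !hornerE. Qed.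

(** The scalar c is the factor det P by which the polynomial path differs from
    the symplectic one. *)
Lemma Sp_near_separable (R : realType) (n : nat) (A : 'M[R]_(n + n))
    (U : set 'M[R]_(n + n)) : (0 < n)%N -> Sp R n A -> nbhs A U ->
  exists (B : 'M[R]_(n + n)) (c : R), [/\ Sp R n B, U B, c != 0
    & separable_poly (char_poly (c *: B))].
Proof.
move=> n0 /Sp_scaled_gauss_factor[N [S [P [T [[symN symS symT uP] AE]]]]] nU.
pose D := diag_mx (\row_(i < n) (i.+2%:R : R)).
pose M := scaled_gauss (segment_mx N 0) (segment_mx S 0) (segment_mx P D)
  (segment_mx T 0).
pose d := \det (segment_mx P D).
pose at_ (t : R) (B C : 'M[R]_n) := (1 - t) *: B + t *: C.
have ME t : map_mx (horner_eval t) M =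
    scaled_gauss (at_ t N 0) (at_ t S 0) (at_ t P D) (at_ t T 0).
  by rewrite map_scaled_gauss !horner_segment_mx.
have dE t : d.[t] = \det (at_ t P D).
  by rewrite -[LHS]/(horner_eval t d) -det_map_mx horner_segment_mx.
have at0 B C : at_ 0 B C = B by rewrite /at_ subr0 scale1r scale0r addr0.
have at1 B C : at_ 1 B C = C by rewrite /at_ subrr scale1r scale0r add0r.
have d0 : d.[0] != 0 by rewrite dE at0 -unitfE -unitmxE.
pose r := resultant (char_poly M) (char_poly M)^`().
have rE t : (r.[t] != 0) =
    separable_poly (char_poly (map_mx (horner_eval t) M)).
  by rewrite horner_resultant_char_poly // addn_gt0 n0.
(* The other end of the path is the scaled diagonal matrix. *)
have r1 : r.[1] != 0.
  rewrite rE ME !at1 /scaled_gauss /shear_lo /shear_up -scalar_mx_block.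
  by rewrite !mul1mx mulmx1 separable_scaled_levi.
(* The two conditions on t, that P is invertible and that the eigenvalues are
   distinct, exclude the roots of this nonzero polynomial. *)
have dr0 : d * r != 0.
  by rewrite mulf_neq0 //; [move: d0 | move: r1];
    apply: contra_neq => ->; rewrite horner0.
have AE0 : d.[0]^-1 *: map_mx (horner_eval 0) M = A by rewrite dE ME !at0 -AE.
have nearU : \forall t \near (0 : R)^',
    U (d.[t]^-1 *: map_mx (horner_eval t) M).
  apply: nbhs_dnbhs; have := @cvg_rational_mx R _ M d 0 d0.
  by rewrite AE0; apply.
have [t [Ut]] := filter_ex (filterI nearU (near0_horner_neq0 dr0)).
rewrite /= hornerM mulf_eq0 negb_or => /andP[dt rt].
exists (d.[t]^-1 *: map_mx (horner_eval t) M), d.[t]; split=> //.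
  rewrite ME dE; apply: Sp_scaled_gauss; last by rewrite unitmxE unitfE -dE.
  - by rewrite /at_ linearD !linearZ /= symN trmx0.
  - by rewrite /at_ linearD !linearZ /= symS trmx0.
  - by rewrite /at_ linearD !linearZ /= symT trmx0.
by rewrite scalerA mulfV // scale1r -rE.
Qed.

Theorem proposition26 (R : realType) (n : nat) (hn : (1 <= n)%N) :
  dense [set A : Sp R n | semisimple (complexify (set_val A)) /\
                          distinct_eigenvalues (complexify (set_val A))].
Proof.
move=> O [A OA] [U oU UO]; rewrite -UO in OA.
have spA : Sp R n (set_val A) by exact: set_valP.
have nU : nbhs (set_val A) U by apply: open_nbhs_nbhs; split.
have [B [c [spB UB c0 sepB]]] := Sp_near_separable hn spA nU.
have distB : distinct_eigenvalues (complexify B).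
  have -> : complexify B = (real_complex R c)^-1 *: complexify (c *: B).
    by rewrite /complexify map_mxZ scalerA mulVf ?scale1r // fmorph_eq0.
  apply: distinct_eigenvaluesZ; first by rewrite invr_eq0 fmorph_eq0.
  apply: separable_distinct_eigenvalues.
  by rewrite /complexify -map_char_poly separable_map.
exists (SigSub (mem_set spB)); split; first by rewrite -UO.
by split=> //; exact: distinct_eigenvalues_semisimple.
Qed.
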